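(* Let $\mathcal{C}$ be a monoidal category, $\mathcal{C}^{piv}$ its pivotal cover and $H:\mathcal{C}^{piv}\to\mathcal{C}$ the forgetful functor $(P,Q)\mapsto P$. Then $\mathcal{C}^{piv}$ is pivotal and satisfies the following universal property: if $\mathcal{D}$ is a pivotal monoidal category and $G:\mathcal{D}\to\mathcal{C}$ is a strong monoidal functor, then there exists a unique functor $G':\mathcal{D}\to\mathcal{C}^{piv}$ such that $G=HG'$ and $G'$ respects (preserves) the pivotal structures.
   Context: Monoidal categories are assumed strict; object names also denote identity morphisms. Duals: a left dual of $X$ is an object ${}^{\vee}X$ with $\mathrm{ev}_X:{}^{\vee}X\otimes X\to\mathbf 1$, $\mathrm{coev}_X:\mathbf 1\to X\otimes{}^{\vee}X$ satisfying the two triangle identities; a right dual $X^{\vee}$ has $\underline{\mathrm{ev}}_X:X\otimes X^{\vee}\to\mathbf 1$, $\underline{\mathrm{coev}}_X:\mathbf 1\to X^{\vee}\otimes X$ making $X$ a left dual of $X^\vee$. A category is rigid if every object has left and right duals (with chosen duals). For $f:X\to Y$, ${}^{\vee}f=(\mathrm{ev}_Y\otimes{}^{\vee}X)({}^{\vee}Y\otimes f\otimes{}^{\vee}X)({}^{\vee}Y\otimes\mathrm{coev}_X)$. Pivotal category: a rigid monoidal category equipped with a monoidal natural isomorphism $\varrho:\mathrm{id}\to{}^{\vee\vee}(-)$ (the pivotal structure). Pivotal pair $(P,Q)$ in $\mathcal{C}$: objects $P,Q$ together with morphisms $\mathrm{coev}:\mathbf 1\to P\otimes Q$, $\mathrm{ev}:Q\otimes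 P\to\mathbf 1$ making $Q$ a left dual of $P$, and $\underline{\mathrm{coev}}:\mathbf 1\to Q\otimes P$, $\underline{\mathrm{ev}}:P\otimes Q\to\mathbf 1$ making $Q$ a right dual of $P$ (these morphisms are part of the data). Pivotal morphism $(P_1,Q_1)\to(P_2,Q_2)$: a morphism $f:P_1\to P_2$ in $\mathcal{C}$ such that $$(\mathrm{ev}_2\otimes Q_1)(Q_2\otimes f\otimes Q_1)(Q_2\otimes\mathrm{coev}_1)=(Q_1\otimes\underline{\mathrm{ev}}_2)(Q_1\otimes f\otimes Q_2)(\underline{\mathrm{coev}}_1\otimes Q_2):Q_2\to Q_1 .$$ Pivotal cover $\mathcal{C}^{piv}$: objects are the pivotal pairs of $\mathcal{C}$, morphisms the pivotal morphisms. It is monoidal with $(P_1,Q_1)\otimes(P_2,Q_2)=(P_1\otimes P_2,Q_2\otimes Q_1)$ (with the nested duality morphisms), and $H$ is strict monoidal. It is rigid with chosen left and right dual of $(P,Q)$ both equal to $(Q,P)$ (with the duality morphisms of the pair swapped), and both duality functors send $f:(P_1,Q_1)\to(P_2,Q_2)$ to the common morphism $Q_2\to Q_1$ displayed above; so ${}^{\vee\vee}(P,Q)=(P,Q)$, and its pivotal structure is given by identity morphisms. Preservation of pivotal structures: for a strong monoidal functor $F$ between rigid categories, with structure isomorphisms $F_2(X,Y):F(X)\otimes F(Y)\to F(X\otimes Y)$ and $F_0:\mathbf 1\to F(\mathbf 1)$, let $\zeta_X:F({}^{\vee}X)\to{}^{\vee}F(X)$ be the isomorphism $\zeta_X=(F_0^{-1}F(\mathrm{ev}_X)F_2({}^{\vee}X,X)\otimes{}^{\vee}F(X))(F({}^{\vee}X)\otimes\mathrm{coev}_{F(X)})$.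 If the source and target have pivotal structures $\varrho$ and $\varrho'$, then $F$ preserves (respects) the pivotal structures if $\varrho'_{F(X)}={}^{\vee}(\zeta_X^{-1})\,\zeta_{{}^{\vee}X}\,F(\varrho_X)$ for all objects $X$ (in particular this notion refers to a strong monoidal functor).
   Formalization: Strict uniqueness of G' fails (Q in (P,Q) can be replaced by an isomorphic object); the formal theorem states that G' is unique up to a unique monoidal natural isomorphism lying over the identity of G, with G' and its competitors strong monoidal and G=HG' strict as monoidal functors. *)

(* Defs.v *)
From Stdlib Require Import ssreflect ssrfun.
From Stdlib Require Import ProofIrrelevance FunctionalExtensionality ClassicalEpsilon.

Set Implicit Arguments.
Unset Strict Implicit.
Unset Printing Implicit Defensive.
Set Primitive Projections.

Declare Scope moncat_scope.
Delimit Scope moncat_scope with moncat.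
Local Open Scope moncat_scope.

Reserved Notation "f ≡ g" (at level 70, no associativity).
Reserved Notation "g ∘ f" (at level 40, left associativity).
Reserved Notation "g ⊙ f" (at level 40, left associativity).
Reserved Notation "X ⊗ Y" (at level 35, right associativity).
Reserved Notation "f ⊗₁ g" (at level 39, no associativity).
Reserved Notation "f ▷ X" (at level 37, left associativity).
Reserved Notation "X ◁ f" (at level 38, right associativity).

(** * Categories *)

Record category := Category {
  ob :> Type;
  hom : ob -> ob -> Type;
  idm : forall X, hom X X;
  comp : forall X Y Z, hom Y Z -> hom X Y -> hom X Z;
  compA : forall X Y Z W (h : hom Z W) (g : hom Y Z) (f : hom X Y),
    comp h (comp g f) = comp (comp h g) f;
  comp1m : forall X Y (f : hom X Y), comp (idm Y) f = f;
  compm1 : forall X Y (f : hom X Y), comp f (idm X) = f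
}.
Arguments idm {_} _.
Notation "g ∘ f" := (comp g f) : moncat_scope.

(** [f ≡ g] : equality of two morphisms as arrows, sources and targets
    included.  It makes sense for [f : hom X Y] and [g : hom X' Y'] whose
    endpoints are only provably equal, as happens under strictness. *)
Record arrow (C : category) := Arrow { src : C; tgt : C; arr : hom src tgt }.
Arguments Arrow {C src tgt} arr.
Notation "f ≡ g" := (Arrow f = Arrow g) : moncat_scope.

Definition is_inverse (C : category) (X Y : C) (f : hom X Y) (g : hom Y X) :=
  g ∘ f = idm X /\ f ∘ g = idm Y.

Record iso (C : category) (X Y : C) := Iso {
  fwd :> hom X Y;
  bwd : hom Y X;
  isoP : is_inverse fwd bwd
}.

(** * Strict monoidal categories *)

Record moncat := Moncat {
  mcat :> category;
  tens : mcat -> mcat -> mcat;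
  unit1 : mcat;
  tensm : forall X Y X' Y', @hom mcat X Y -> @hom mcat X' Y' ->
    @hom mcat (tens X X') (tens Y Y');
  tensm1 : forall X Y, tensm (idm X) (idm Y) = idm (tens X Y);
  tensmM : forall X Y Z X' Y' Z' (g : hom Y Z) (f : hom X Y)
      (g' : hom Y' Z') (f' : hom X' Y'),
    tensm (g ∘ f) (g' ∘ f') = tensm g g' ∘ tensm f f';
  tensA : forall X Y Z, tens (tens X Y) Z = tens X (tens Y Z);
  tens1x : forall X, tens unit1 X = X;
  tensx1 : forall X, tens X unit1 = X;
  tensmA : forall X Y X' Y' X'' Y''
      (f : hom X Y) (g : hom X' Y') (h : hom X'' Y''),
    tensm (tensm f g) h ≡ tensm f (tensm g h);
  tens1m : forall X Y (f : hom X Y), tensm (idm unit1) f ≡ f;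
  tensm1r : forall X Y (f : hom X Y), tensm f (idm unit1) ≡ f
}.
Arguments unit1 {_}.
Notation "X ⊗ Y" := (tens X Y) : moncat_scope.
Notation "f ⊗₁ g" := (tensm f g) : moncat_scope.
Notation "𝟙" := unit1 : moncat_scope.
Notation "X ◁ f" := (tensm (idm X) f) : moncat_scope.
Notation "f ▷ X" := (tensm f (idm X)) : moncat_scope.

(** Objects such as [(X ⊗ Y) ⊗ Z] and [X ⊗ (Y ⊗ Z)] are equal but not
    convertible.  [g ⊙ f] composes, and [⌊ f ⌋] retypes, along such equalities;
    these are found by instance search and are irrelevant, being proofs of
    equations. *)
Class strict_eq (C : moncat) (X Y : C) : Prop := strict_eqP : X = Y.

Ltac strictness :=
  unfold strict_eq; rewrite ?(tensA, tens1x, tensx1); reflexivity.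
#[export] Hint Extern 0 (strict_eq _ _) => strictness : typeclass_instances.

Definition recast (C : moncat) (X Y X' Y' : C) (f : hom X Y)
    (eX : strict_eq X X') (eY : strict_eq Y Y') : hom X' Y' :=
  match eX in _ = X0, eY in _ = Y0 return hom X0 Y0 with
  | eq_refl, eq_refl => f
  end.
Arguments recast {C X Y X' Y'} f {eX eY}.
Arguments recast : simpl never.
Notation "⌊ f ⌋" := (recast f) (format "⌊ f ⌋") : moncat_scope.

Definition scomp (C : moncat) (X Y Y' Z : C) (g : hom Y' Z) (f : hom X Y)
    (e : strict_eq Y Y') : hom X Z :=
  g ∘ match e in _ = Y0 return hom X Y0 with eq_refl => f end.
Arguments scomp {C X Y Y' Z} g f {e}.
Arguments scomp : simpl never.
Notation "g ⊙ f" := (scomp g f) : moncat_scope.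

(** * Duals and pivotal structures *)

(** [Q], [ev], [coev] is a left dual of [P]; equivalently [P], [ev], [coev]
    is a right dual of [Q]. *)
Definition is_dual (C : moncat) (P Q : C) (ev : hom (Q ⊗ P) 𝟙)
    (coev : hom 𝟙 (P ⊗ Q)) : Prop :=
  (P ◁ ev) ⊙ (coev ▷ P) ≡ idm P /\ (ev ▷ Q) ⊙ (Q ◁ coev) ≡ idm Q.

(** Chosen left and right duals, as bare data; the triangle identities are
    [is_rigid]. *)
Record duality (C : moncat) := Duality {
  ldual : C -> C;
  lev : forall X, hom (ldual X ⊗ X) 𝟙;
  lcoev : forall X, hom 𝟙 (X ⊗ ldual X);
  rdual : C -> C;
  rev : forall X, hom (X ⊗ rdual X) 𝟙;
  rcoev : forall X, hom 𝟙 (rdual X ⊗ X)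
}.
Arguments ldual {C} _ _.
Arguments lev {C} _ _.
Arguments lcoev {C} _ _.
Arguments rdual {C} _ _.
Arguments rev {C} _ _.
Arguments rcoev {C} _ _.

Definition is_rigid (C : moncat) (d : duality C) : Prop :=
  (forall X, is_dual (lev d X) (lcoev d X)) /\
  (forall X, is_dual (rev d X) (rcoev d X)).

(** For arbitrary duals [X'], [Y'] of [X], [Y], the two ways of transposing
    [f : X -> Y] into a morphism [Y' -> X']. *)
Definition ltranspose (C : moncat) (X Y X' Y' : C) (evY : hom (Y' ⊗ Y) 𝟙)
    (coevX : hom 𝟙 (X ⊗ X')) (f : hom X Y) : hom Y' X' :=
  ⌊(evY ▷ X') ⊙ (Y' ◁ f ▷ X') ⊙ (Y' ◁ coevX)⌋.

Definition rtranspose (C : moncat) (X Y X' Y' : C) (revY : hom (Y ⊗ Y') 𝟙)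
    (rcoevX : hom 𝟙 (X' ⊗ X)) (f : hom X Y) : hom Y' X' :=
  ⌊(X' ◁ revY) ⊙ (X' ◁ f ▷ Y') ⊙ (rcoevX ▷ Y')⌋.

Definition ldualm (C : moncat) (d : duality C) (X Y : C) (f : hom X Y) :
    hom (ldual d Y) (ldual d X) :=
  ltranspose (lev d Y) (lcoev d X) f.

(** The canonical morphism [ᵛY ⊗ ᵛX -> ᵛ(X ⊗ Y)] and its inverse. *)
Definition ldual2 (C : moncat) (d : duality C) (X Y : C) :
    hom (ldual d Y ⊗ ldual d X) (ldual d (X ⊗ Y)) :=
  ⌊(lev d Y ▷ ldual d (X ⊗ Y))
    ⊙ (ldual d Y ◁ lev d X ▷ (Y ⊗ ldual d (X ⊗ Y)))
    ⊙ ((ldual d Y ⊗ ldual d X) ◁ lcoev d (X ⊗ Y))⌋.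

Definition ldual2V (C : moncat) (d : duality C) (X Y : C) :
    hom (ldual d (X ⊗ Y)) (ldual d Y ⊗ ldual d X) :=
  ⌊(lev d (X ⊗ Y) ▷ (ldual d Y ⊗ ldual d X))
    ⊙ ((ldual d (X ⊗ Y) ⊗ X) ◁ lcoev d Y ▷ ldual d X)
    ⊙ (ldual d (X ⊗ Y) ◁ lcoev d X)⌋.

(** The canonical morphism [𝟙 -> ᵛ𝟙] and its inverse. *)
Definition ldual0 (C : moncat) (d : duality C) : hom 𝟙 (ldual d 𝟙) :=
  ⌊lcoev d 𝟙⌋.

Definition ldual0V (C : moncat) (d : duality C) : hom (ldual d 𝟙) 𝟙 :=
  ⌊lev d 𝟙⌋.

(** The monoidal structure of the double dual functor [ᵛᵛ(-)]: the canonical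
    morphism for [ᵛY, ᵛX] followed by the dual of the inverse of the one for
    [X, Y]. *)
Definition lldual2 (C : moncat) (d : duality C) (X Y : C) :
    hom (ldual d (ldual d X) ⊗ ldual d (ldual d Y))
        (ldual d (ldual d (X ⊗ Y))) :=
  ldualm d (ldual2V d X Y) ∘ ldual2 d (ldual d Y) (ldual d X).

Definition lldual0 (C : moncat) (d : duality C) :
    hom 𝟙 (ldual d (ldual d 𝟙)) :=
  ldualm d (ldual0V d) ∘ ldual0 d.

Record pivotal_data (C : moncat) := PivotalData {
  pdual :> duality C;
  rho : forall X, hom X (ldual pdual (ldual pdual X))
}.
Arguments rho {C} _ _.

Record is_pivotal (C : moncat) (p : pivotal_data C) : Prop := IsPivotal {
  piv_rigid : is_rigid p;
  piv_iso : forall X, exists g, is_inverse (rho p X) g;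
  piv_nat : forall (X Y : C) (f : hom X Y),
    rho p Y ∘ f = ldualm p (ldualm p f) ∘ rho p X;
  piv_tens : forall X Y,
    rho p (X ⊗ Y) = lldual2 p X Y ∘ (rho p X ⊗₁ rho p Y);
  piv_unit : rho p 𝟙 = lldual0 p
}.

(** * Strong monoidal functors *)

Record smfunctor (D C : moncat) := SMFunctor {
  fob :> D -> C;
  fmap : forall X Y, hom X Y -> hom (fob X) (fob Y);
  fmap1 : forall X, fmap (idm X) = idm (fob X);
  fmapM : forall (X Y Z : D) (g : hom Y Z) (f : hom X Y),
    fmap (g ∘ f) = fmap g ∘ fmap f;
  fun2 : forall X Y, iso (fob X ⊗ fob Y) (fob (X ⊗ Y));
  fun0 : iso 𝟙 (fob 𝟙);
  fun2_nat : forall (X Y X' Y' : D) (f : hom X Y) (f' : hom X' Y'),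
    fmap (f ⊗₁ f') ∘ fun2 X X' = fun2 Y Y' ∘ (fmap f ⊗₁ fmap f');
  fun2A : forall X Y Z,
    fun2 (X ⊗ Y) Z ∘ (fun2 X Y ▷ fob Z) ≡ fun2 X (Y ⊗ Z) ∘ (fob X ◁ fun2 Y Z);
  fun21l : forall X, fun2 𝟙 X ∘ (fun0 ▷ fob X) ≡ idm (fob X);
  fun21r : forall X, fun2 X 𝟙 ∘ (fob X ◁ fun0) ≡ idm (fob X)
}.
Arguments fmap {D C} _ {X Y} _.
Arguments fun2 {D C} _ _ _.
Arguments fun0 {D C} _.

(** The comparison morphism [F(ᵛX) -> ᵛF(X)]. *)
Definition zeta (D C : moncat) (d : duality D) (c : duality C)
    (F : smfunctor D C) (X : D) : hom (F (ldual d X)) (ldual c (F X)) :=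
  ⌊((bwd (fun0 F) ∘ fmap F (lev d X) ∘ fun2 F (ldual d X) X)
      ▷ ldual c (F X))
    ⊙ (F (ldual d X) ◁ lcoev c (F X))⌋.

Definition preserves_pivotal (D C : moncat) (d : pivotal_data D)
    (c : pivotal_data C) (F : smfunctor D C) : Prop :=
  forall X, exists zi, is_inverse (zeta d c F X) zi /\
    rho c (F X) = ldualm c zi ∘ zeta d c F (ldual d X) ∘ fmap F (rho d X).

Record is_monoidal_iso (D C : moncat) (F G : smfunctor D C)
    (t : forall X, hom (F X) (G X)) : Prop := IsMonoidalIso {
  mi_nat : forall (X Y : D) (f : hom X Y), t Y ∘ fmap F f = fmap G f ∘ t X;
  mi_tens : forall X Y, t (X ⊗ Y) ∘ fun2 F X Y = fun2 G X Y ∘ (t X ⊗₁ t Y);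
  mi_unit : t 𝟙 ∘ fun0 F = fun0 G;
  mi_iso : forall X, exists g, is_inverse (t X) g
}.

(** * Calculus of arrows

    Equations modulo strictness are proved on [option (arrow C)], on which
    composition is total and associative. *)

Lemma arrow_inj (C : category) (X Y : C) (f g : hom X Y) : f ≡ g -> f = g.
Proof.
move=> e; pose T (p : C * C) := hom (fst p) (snd p).
pose st (a : arrow C) := existT T (src a, tgt a) (arr a).
by have := f_equal st e; rewrite /st /=; apply: (inj_pair2 _ T (X, Y)).
Qed.

Lemma arrow_src (C : category) (X Y X' Y' : C) (f : hom X Y) (g : hom X' Y') :
  f ≡ g -> X = X'.
Proof. by move=> e; exact: (f_equal (@src C) e). Qed.

Lemma arrow_tgt (C : category) (X Y X' Y' : C) (f : hom X Y) (g : hom X' Y') :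
  f ≡ g -> Y = Y'.
Proof. by move=> e; exact: (f_equal (@tgt C) e). Qed.

Definition pk (C : category) (X Y : C) (f : hom X Y) : option (arrow C) :=
  Some (Arrow f).

Lemma pkE (C : category) (X Y X' Y' : C) (f : hom X Y) (g : hom X' Y') :
  pk f = pk g -> f ≡ g.
Proof. exact: (f_equal (fun o => if o is Some a then a else Arrow f)). Qed.

Lemma pk_inj (C : category) (X Y : C) (f g : hom X Y) : pk f = pk g -> f = g.
Proof. by move/pkE/arrow_inj. Qed.

Definition oc (C : category) (b a : option (arrow C)) : option (arrow C) :=
  match b, a with
  | Some b, Some a =>
    match excluded_middle_informative (tgt a = src b) with
    | left e => Some (Arrow (arr b ∘
        match e in _ = Z return hom (src a) Z with eq_refl => arr a end))
    | right _ => None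
    end
  | _, _ => None
  end.

Definition ot (C : moncat) (a b : option (arrow C)) : option (arrow C) :=
  match a, b with
  | Some a, Some b => Some (Arrow (arr a ⊗₁ arr b))
  | _, _ => None
  end.

Lemma pk_comp (C : category) (X Y Z : C) (g : hom Y Z) (f : hom X Y) :
  pk (g ∘ f) = oc (pk g) (pk f).
Proof.
rewrite /oc /=; case: excluded_middle_informative => // e.
by rewrite (proof_irrelevance _ e eq_refl).
Qed.

Lemma ocA (C : category) (c b a : option (arrow C)) :
  oc c (oc b a) = oc (oc c b) a.
Proof.
case: c b a => [[Z W h]|] [[Y Z' g]|] [[X Y' f]|] //=; last first.
  by case: excluded_middle_informative.
case: (excluded_middle_informative (Y' = Y)) => [e|ne] /=.
  subst Y'; case: (excluded_middle_informative (Z' = Z)) => [e|//] /=.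
  subst Z'; case: excluded_middle_informative => // e.
  by rewrite (proof_irrelevance _ e eq_refl) compA.
by case: (excluded_middle_informative (Z' = Z)) => [e|//] /=;
  case: excluded_middle_informative.
Qed.

Lemma oc1m (C : category) (X Y Y' : C) (f : hom X Y) :
  Y = Y' -> oc (pk (idm Y')) (pk f) = pk f.
Proof. by move=> <-; rewrite -pk_comp comp1m. Qed.

Lemma ocm1 (C : category) (X X' Y : C) (f : hom X Y) :
  X = X' -> oc (pk f) (pk (idm X')) = pk f.
Proof. by move=> <-; rewrite -pk_comp compm1. Qed.

Section Calculus.
Variable C : moncat.
Implicit Types (X Y Z P Q : C).

Lemma pk_recast X Y X' Y' (f : hom X Y) (eX : strict_eq X X')
  (eY : strict_eq Y Y') : pk (@recast C X Y X' Y' f eX eY) = pk f.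
Proof. by case: Y' / eY; case: X' / eX. Qed.

Lemma pk_scomp X Y Y' Z (g : hom Y' Z) (f : hom X Y) (e : strict_eq Y Y') :
  pk (@scomp C X Y Y' Z g f e) = oc (pk g) (pk f).
Proof. by case: Y' / e g => g; rewrite -pk_comp. Qed.

Lemma pk_tens X Y X' Y' (f : hom X Y) (g : hom X' Y') :
  pk (f ⊗₁ g) = ot (pk f) (pk g).
Proof. by []. Qed.

Lemma otA (a b c : option (arrow C)) : ot (ot a b) c = ot a (ot b c).
Proof.
by case: a b c => [[X Y f]|] [[X' Y' g]|] [[X'' Y'' h]|] //=; rewrite tensmA.
Qed.

Lemma ot1m (a : option (arrow C)) : ot (pk (idm 𝟙)) a = a.
Proof. by case: a => [[X Y f]|] //=; rewrite tens1m. Qed.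

Lemma otm1 (a : option (arrow C)) : ot a (pk (idm 𝟙)) = a.
Proof. by case: a => [[X Y f]|] //=; rewrite tensm1r. Qed.

Lemma pk_id X Y : pk (idm (X ⊗ Y)) = ot (pk (idm X)) (pk (idm Y)).
Proof. by rewrite -pk_tens tensm1. Qed.

Definition odom (a : option (arrow C)) := if a is Some f then Some (src f) else None.
Definition ocod (a : option (arrow C)) := if a is Some f then Some (tgt f) else None.

Lemma odom_oc b a : ocod a = odom b -> odom (oc b a) = odom a.
Proof.
case: b a => [[Y' Z g]|] [[X Y f]|] //=; case=> e.
by case: excluded_middle_informative.
Qed.

Lemma ocod_oc b a : ocod a = odom b -> ocod (oc b a) = ocod b.
Proof.
case: b a => [[Y' Z g]|] [[X Y f]|] //=; case=> e.
by case: excluded_middle_informative.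
Qed.

Lemma ot_oc b a b' a' : ocod a = odom b -> ocod a' = odom b' ->
  ot (oc b a) (oc b' a') = oc (ot b b') (ot a a').
Proof.
case: b a b' a' => [[Y0 Z g]|] [[X Y f]|] [[Y0' Z' g']|] [[X' Y' f']|] //=;
  last by move=> _ _; case: excluded_middle_informative.
case=> e [e']; subst Y0 Y0'.
by have := pk_comp (g ⊗₁ g') (f ⊗₁ f'); rewrite -tensmM pk_tens !pk_comp.
Qed.

Arguments oc : simpl never.

Lemma wl_oc X b a : ocod a = odom b ->
  ot (pk (idm X)) (oc b a) = oc (ot (pk (idm X)) b) (ot (pk (idm X)) a).
Proof. by move=> e; rewrite -ot_oc // oc1m. Qed.

Lemma wr_oc X b a : ocod a = odom b ->
  ot (oc b a) (pk (idm X)) = oc (ot b (pk (idm X))) (ot a (pk (idm X))).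
Proof. by move=> e; rewrite -ot_oc // oc1m. Qed.

Lemma wr_oc' (c b a : option (arrow C)) : ocod a = odom b -> ocod c = odom c -> oc c c = c ->
  ot (oc b a) c = oc (ot b c) (ot a c).
Proof. by move=> e e' ec; rewrite -ot_oc // ec. Qed.

Lemma oc1 X a : ocod a = Some X -> oc (pk (idm X)) a = a.
Proof. by case: a => [[Y Z f]|] //= [e]; subst; exact: oc1m. Qed.

Lemma oc1r X a : odom a = Some X -> oc a (pk (idm X)) = a.
Proof. by case: a => [[Y Z f]|] //= [e]; subst; exact: ocm1. Qed.

Lemma slide_l X Y a b : odom a = Some X -> ocod b = Some Y ->
  oc (ot a (pk (idm Y))) (ot (pk (idm X)) b) = ot a b.
Proof. by move=> ea eb; rewrite -ot_oc ?oc1 ?oc1r. Qed.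

Lemma slide_r X Y a b : ocod a = Some X -> odom b = Some Y ->
  oc (ot (pk (idm X)) b) (ot a (pk (idm Y))) = ot a b.
Proof. by move=> ea eb; rewrite -ot_oc ?oc1 ?oc1r. Qed.

Lemma slide X X' Y Y' a b :
  odom a = Some X -> ocod a = Some X' -> odom b = Some Y -> ocod b = Some Y' ->
  oc (ot (pk (idm X')) b) (ot a (pk (idm Y))) =
  oc (ot a (pk (idm Y'))) (ot (pk (idm X)) b).
Proof. by move=> *; rewrite slide_l ?slide_r. Qed.

Lemma pk_is_dual (P Q : C) (ev : hom (Q ⊗ P) 𝟙) (coev : hom 𝟙 (P ⊗ Q)) :
  is_dual ev coev <->
  oc (ot (pk (idm P)) (pk ev)) (ot (pk coev) (pk (idm P))) = pk (idm P) /\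
  oc (ot (pk ev) (pk (idm Q))) (ot (pk (idm Q)) (pk coev)) = pk (idm Q).
Proof.
rewrite /is_dual -!pk_tens; split=> [][e1 e2]; split.
- by rewrite -(pk_scomp _ _ _) /pk e1.
- by rewrite -(pk_scomp _ _ _) /pk e2.
- by apply: pkE; rewrite pk_scomp.
- by apply: pkE; rewrite pk_scomp.
Qed.

Lemma pk_ltranspose X Y X' Y' (evY : hom (Y' ⊗ Y) 𝟙)
    (coevX : hom 𝟙 (X ⊗ X')) (f : hom X Y) :
  pk (ltranspose evY coevX f) =
  oc (ot (pk evY) (pk (idm X')))
    (oc (ot (pk (idm Y')) (ot (pk f) (pk (idm X'))))
      (ot (pk (idm Y')) (pk coevX))).
Proof. by rewrite pk_recast !pk_scomp -ocA. Qed.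

Lemma pk_rtranspose X Y X' Y' (revY : hom (Y ⊗ Y') 𝟙)
    (rcoevX : hom 𝟙 (X' ⊗ X)) (f : hom X Y) :
  pk (rtranspose revY rcoevX f) =
  oc (ot (pk (idm X')) (pk revY))
    (oc (ot (pk (idm X')) (ot (pk f) (pk (idm Y'))))
      (ot (pk rcoevX) (pk (idm Y')))).
Proof. by rewrite pk_recast !pk_scomp -ocA. Qed.

End Calculus.

Ltac side := first
  [ rewrite odom_oc; [side|side] | rewrite ocod_oc; [side|side]
  | by rewrite /= ?(tensA, tens1x, tensx1) ].
Ltac flat := rewrite ?(pk_recast, pk_scomp, pk_comp, pk_tens, pk_id, otA, ot1m, otm1).

Ltac ids := by rewrite -?pk_id ?oc1m.
Ltac dist := repeat first
  [rewrite wl_oc; [side|] | rewrite wr_oc'; [side|side|ids|]]; rewrite ?otA -?ocA.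
Ltac distin H := repeat first
  [rewrite wl_oc in H; [side|] | rewrite wr_oc' in H; [side|side|ids|]];
  rewrite ?(otA, ot1m, otm1) -?ocA in H.

(** * The pivotal cover *)

Definition tens_ev (C : moncat) (P1 Q1 P2 Q2 : C) (ev1 : hom (Q1 ⊗ P1) 𝟙)
    (ev2 : hom (Q2 ⊗ P2) 𝟙) : hom ((Q2 ⊗ Q1) ⊗ (P1 ⊗ P2)) 𝟙 :=
  ⌊ev2 ⊙ (Q2 ◁ ev1 ▷ P2)⌋.

Definition tens_coev (C : moncat) (P1 Q1 P2 Q2 : C)
    (coev1 : hom 𝟙 (P1 ⊗ Q1)) (coev2 : hom 𝟙 (P2 ⊗ Q2)) :
    hom 𝟙 ((P1 ⊗ P2) ⊗ (Q2 ⊗ Q1)) :=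
  ⌊(P1 ◁ coev2 ▷ Q1) ⊙ coev1⌋.

Section DualCalculus.
Variable C : moncat.
Implicit Types (X Y Z P Q : C).
Local Notation I X := (pk (idm X)).


Lemma dual_tens (P1 Q1 P2 Q2 : C) (ev1 : hom (Q1 ⊗ P1) 𝟙) (coev1 : hom 𝟙 (P1 ⊗ Q1))
    (ev2 : hom (Q2 ⊗ P2) 𝟙) (coev2 : hom 𝟙 (P2 ⊗ Q2)) :
  is_dual ev1 coev1 -> is_dual ev2 coev2 ->
  is_dual (tens_ev ev1 ev2) (tens_coev coev1 coev2).
Proof.
move=> /pk_is_dual [l1 r1] /pk_is_dual [l2 r2]; apply/pk_is_dual; split.
  flat; dist.
  have E := slide (a := pk coev2) (b := pk ev1) erefl erefl erefl erefl.
  move/(f_equal (fun a => @ot C (I P1) (@ot C a (I P2)))): E.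
  dist; flat=> E; rewrite [X in oc _ X]ocA E -!ocA.
  move/(f_equal (fun a => @ot C a (I P2))): l1; dist => ->.
  move/(f_equal (fun a => @ot C (I P1) a)): l2; dist; rewrite ocA => ->.
  by rewrite -pk_id oc1m.
flat; dist.
have E := slide (a := pk ev1) (b := pk coev2) erefl erefl erefl erefl.
move/(f_equal (fun a => @ot C (I Q2) (@ot C a (I Q1)))): E.
dist; flat=> E; rewrite [X in oc _ X]ocA -E -!ocA.
move/(f_equal (fun a => @ot C (I Q2) a)): r1; dist => ->.
move/(f_equal (fun a => @ot C a (I Q1))): r2; dist; rewrite ocA => ->.
by rewrite -pk_id oc1m.
Qed.

(** The left transpose of [f] is the only [h] such that
    [ev ∘ (h ⊗ X) = ev ∘ (Y' ⊗ f)]; similarly on the right. *)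
Lemma ltransposeP (X Y X' Y' : C) (evX : hom (X' ⊗ X) 𝟙)
    (coevX : hom 𝟙 (X ⊗ X')) (evY : hom (Y' ⊗ Y) 𝟙)
    (f : hom X Y) (h : hom Y' X') : is_dual evX coevX ->
  h = ltranspose evY coevX f <-> evX ∘ (h ▷ X) = evY ∘ (Y' ◁ f).
Proof.
move=> /pk_is_dual [l r]; split=> [->|e].
  apply: pk_inj; rewrite !pk_comp !pk_tens pk_ltranspose.
  dist; flat.
  have := slide (a := pk evY) (b := pk evX) erefl erefl erefl erefl.
  flat=> E; rewrite ocA E -!ocA.
  have := slide (a := pk f) (b := pk evX) erefl erefl erefl erefl.
  move/(f_equal (fun a => @ot C (I Y') a)); dist; flat=> {}E.
  rewrite [X in oc _ X]ocA E -!ocA.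
  move/(f_equal (fun a => @ot C (I Y') a)): l; dist; flat=> ->.
  by rewrite -pk_id ocm1.
apply: pk_inj; rewrite pk_ltranspose.
move/(f_equal (@pk _ _ _)): e; flat=> e.
move/(f_equal (fun a => @ot C a (I X'))): e; dist; flat=> e.
rewrite [X in _ = X]ocA -e -!ocA.
have := slide (a := pk h) (b := pk coevX) erefl erefl erefl erefl.
flat=> <-.
by rewrite ocA r oc1m.
Qed.

Lemma rtransposeP (X Y X' Y' : C) (revX : hom (X ⊗ X') 𝟙)
    (rcoevX : hom 𝟙 (X' ⊗ X)) (revY : hom (Y ⊗ Y') 𝟙)
    (f : hom X Y) (h : hom Y' X') : is_dual revX rcoevX ->
  h = rtranspose revY rcoevX f <-> revX ∘ (X ◁ h) = revY ∘ (f ▷ Y').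
Proof.
move=> /pk_is_dual [l r]; split=> [->|e].
  apply: pk_inj; rewrite !pk_comp !pk_tens pk_rtranspose.
  dist; flat.
  have := slide (a := pk revX) (b := pk revY) erefl erefl erefl erefl.
  flat=> E; rewrite ocA -E -!ocA.
  have := slide (a := pk revX) (b := pk f) erefl erefl erefl erefl.
  move/(f_equal (fun a => @ot C a (I Y'))); dist; flat=> {}E.
  rewrite [X in oc _ X]ocA -E -!ocA.
  move/(f_equal (fun a => @ot C a (I Y'))): r; dist; flat=> ->.
  by rewrite -pk_id ocm1.
apply: pk_inj; rewrite pk_rtranspose.
move/(f_equal (@pk _ _ _)): e; flat=> e.
move/(f_equal (fun a => @ot C (I X') a)): e; dist; flat=> e.
rewrite [X in _ = X]ocA -e -!ocA.
have := slide (a := pk rcoevX) (b := pk h) erefl erefl erefl erefl.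
flat=> ->.
by rewrite ocA l oc1m.
Qed.

End DualCalculus.

Section PivotalCover.
Variable C : moncat.

Record pivpair := PivPair {
  pP : C;
  pQ : C;
  pev : hom (pQ ⊗ pP) 𝟙;
  pcoev : hom 𝟙 (pP ⊗ pQ);
  prev : hom (pP ⊗ pQ) 𝟙;
  prcoev : hom 𝟙 (pQ ⊗ pP);
  pev_dual : is_dual pev pcoev;
  prev_dual : is_dual prev prcoev
}.

Definition is_pivmor (p q : pivpair) (f : hom (pP p) (pP q)) : Prop :=
  ltranspose (pev q) (pcoev p) f = rtranspose (prev q) (prcoev p) f.

Record pivmor (p q : pivpair) := PivMor {
  pm :> hom (pP p) (pP q);
  pmP : is_pivmor pm
}.

Lemma pivmor_eq (p q : pivpair) (f g : pivmor p q) :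
  pm f = pm g -> f = g.
Proof.
case: f g => [f fP] [g gP] /= e; subst g.
by rewrite (proof_irrelevance _ fP gP).
Qed.

Lemma is_pivmorP (p q : pivpair) (f : hom (pP p) (pP q)) :
  is_pivmor f <-> exists h, pev p ∘ (h ▷ pP p) = pev q ∘ (pQ q ◁ f) /\
                            prev p ∘ (pP p ◁ h) = prev q ∘ (f ▷ pQ q).
Proof.
split=> [e|[h [/(ltransposeP _ _ _ (pev_dual p)) el]]].
  exists (ltranspose (pev q) (pcoev p) f).
  by split; [apply/(ltransposeP _ _ _ (pev_dual p))
            |apply/(rtransposeP _ _ _ (prev_dual p))].
by move/(rtransposeP _ _ _ (prev_dual p)); rewrite /is_pivmor -el => ->.
Qed.

Lemma is_pivmor1 (p : pivpair) : is_pivmor (idm (pP p) : hom (pP p) (pP p)).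
Proof. by apply/is_pivmorP; exists (idm _); rewrite !tensm1. Qed.

Lemma is_pivmorM (p q r : pivpair) (g : hom (pP q) (pP r))
    (f : hom (pP p) (pP q)) : is_pivmor g -> is_pivmor f -> is_pivmor (g ∘ f).
Proof.
move=> /is_pivmorP [k [kl kr]] /is_pivmorP [h [hl hr]].
apply/is_pivmorP; exists (h ∘ k).
have tl (X Y Z W : C) (b : hom Y Z) (a : hom X Y) : (b ∘ a) ▷ W = (b ▷ W) ∘ (a ▷ W).
  by rewrite -tensmM comp1m.
have tr (X Y Z W : C) (b : hom Y Z) (a : hom X Y) : W ◁ (b ∘ a) = (W ◁ b) ∘ (W ◁ a).
  by rewrite -tensmM comp1m.
have sl (X Y X' Y' : C) (a : hom X Y) (b : hom X' Y') :
  (a ▷ Y') ∘ (X ◁ b) = (Y ◁ b) ∘ (a ▷ X') by rewrite -!tensmM !comp1m !compm1.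
split.
  by rewrite tl tr compA hl -compA -sl compA kl compA.
by rewrite tl tr compA hr -compA sl compA kr compA.
Qed.

Definition piv_id (p : pivpair) : pivmor p p := PivMor (is_pivmor1 p).

Definition piv_comp (p q r : pivpair) (g : pivmor q r) (f : pivmor p q) :
  pivmor p r := PivMor (is_pivmorM (pmP g) (pmP f)).

Definition pivcat : category.
Proof.
refine (@Category pivpair pivmor piv_id piv_comp _ _ _) => *; apply: pivmor_eq.
- exact: compA.
- exact: comp1m.
- exact: compm1.
Defined.

(** [(P1, Q1) ⊗ (P2, Q2) = (P1 ⊗ P2, Q2 ⊗ Q1)]. *)
Definition pivtens (p q : pivpair) : pivpair :=
  PivPair (dual_tens (pev_dual p) (pev_dual q))
          (dual_tens (prev_dual q) (prev_dual p)).

Lemma dual_unit : is_dual (⌊idm 𝟙⌋ : hom (𝟙 ⊗ 𝟙) (𝟙 : C)) ⌊idm 𝟙⌋.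
Proof.
by apply/pk_is_dual; rewrite !pk_recast ot1m oc1m.
Qed.

Definition pivunit : pivpair := PivPair dual_unit dual_unit.

Lemma transpose_tens (X1 X1' X2 X2' Y1 Y1' Y2 Y2' : C)
    (ev1 : hom (X1' ⊗ X1) 𝟙) (ev2 : hom (X2' ⊗ X2) 𝟙)
    (ev1' : hom (Y1' ⊗ Y1) 𝟙) (ev2' : hom (Y2' ⊗ Y2) 𝟙)
    (f1 : hom X1 Y1) (h1 : hom Y1' X1') (f2 : hom X2 Y2) (h2 : hom Y2' X2') :
  ev1 ∘ (h1 ⊗₁ idm X1) = ev1' ∘ (idm Y1' ⊗₁ f1) ->
  ev2 ∘ (h2 ⊗₁ idm X2) = ev2' ∘ (idm Y2' ⊗₁ f2) ->
  tens_ev ev1 ev2 ∘ ((h2 ⊗₁ h1) ▷ (X1 ⊗ X2)) =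
  tens_ev ev1' ev2' ∘ ((Y2' ⊗ Y1') ◁ (f1 ⊗₁ f2)).
Proof.
move=> /(f_equal (@pk _ _ _)); flat=> e1 /(f_equal (@pk _ _ _)); flat=> e2.
apply: pk_inj; rewrite !pk_comp !pk_recast; flat; rewrite -!ocA.
rewrite -ot_oc; [side|side|].
rewrite -[ot (pk h1) _]otA -ot_oc; [side|side|].
rewrite e1 !oc1 //; try (by rewrite ocod_oc; side).
set x := oc (pk ev1') _.
have dx : odom x = Some (Y1' ⊗ X1) by rewrite /x; side.
have cx : ocod x = Some 𝟙 by rewrite /x; side.
have cx2 : ocod (ot x (pk (idm X2))) = Some X2.
  by move: cx; case: (x) => //= a [->]; rewrite tens1x.
rewrite -(slide_l (X := Y2') (Y := X2)) //.
rewrite ocA e2 -ocA -ot_oc //.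
congr (oc _ _); rewrite -ot_oc; [side|side|].
rewrite -[ot _ (ot (pk f1) _)]otA -ot_oc; [side|side|].
rewrite -/x !oc1 //.
by rewrite -(slide_r (X := 𝟙) (Y := X2) (b := pk f2) cx) // ot1m.
Qed.

Lemma is_pivmor_tens (p q p' q' : pivpair) (f : hom (pP p) (pP q))
    (f' : hom (pP p') (pP q')) : is_pivmor f -> is_pivmor f' ->
  @is_pivmor (pivtens p p') (pivtens q q') (f ⊗₁ f').
Proof.
move=> /is_pivmorP [h [hl hr]] /is_pivmorP [h' [hl' hr']].
apply/is_pivmorP; exists (h' ⊗₁ h); split; first exact: transpose_tens.
by symmetry; apply: transpose_tens; symmetry.
Qed.

Definition piv_tensm (p q p' q' : pivpair) (f : pivmor p q) (f' : pivmor p' q') :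
    pivmor (pivtens p p') (pivtens q q') :=
  PivMor (is_pivmor_tens (pmP f) (pmP f')).

Lemma pivpair_eq (p q : pivpair) : pP p = pP q -> pQ p = pQ q ->
  pev p ≡ pev q -> pcoev p ≡ pcoev q -> prev p ≡ prev q ->
  prcoev p ≡ prcoev q -> p = q.
Proof.
case: p q => [P Q e c r d h1 h2] [P' Q' e' c' r' d' h1' h2'] /= eP eQ.
subst P' Q' => /arrow_inj ? /arrow_inj ? /arrow_inj ? /arrow_inj ?; subst.
by rewrite (proof_irrelevance _ h1 h1') (proof_irrelevance _ h2 h2').
Qed.

Lemma pivmor_eqv (p q p' q' : pivpair) (f : @hom pivcat p q)
    (f' : @hom pivcat p' q') : p = p' -> q = q' -> pm f ≡ pm f' -> f ≡ f'.
Proof. by move=> e e'; subst => /arrow_inj/pivmor_eq ->. Qed.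

Lemma pivtensA (p q r : pivpair) :
  pivtens (pivtens p q) r = pivtens p (pivtens q r).
Proof.
by apply: pivpair_eq; rewrite /= ?tensA //; apply: pkE; rewrite !pk_recast;
  flat; dist; flat.
Qed.

Lemma pivtens1x (p : pivpair) : pivtens pivunit p = p.
Proof.
apply: pivpair_eq; rewrite /= ?tens1x ?tensx1 //; apply: pkE;
  rewrite !pk_recast; flat; rewrite ?pk_recast -?pk_id ?ot1m ?otm1 -?pk_id
  ?oc1 ?oc1r //= ?tens1x ?tensx1 //.
Qed.

Lemma pivtensx1 (p : pivpair) : pivtens p pivunit = p.
Proof.
apply: pivpair_eq; rewrite /= ?tens1x ?tensx1 //; apply: pkE;
  rewrite !pk_recast; flat; rewrite ?pk_recast -?pk_id ?ot1m ?otm1 -?pk_id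
  ?oc1 ?oc1r //= ?tens1x ?tensx1 //.
Qed.

Definition pivcover : moncat.
Proof.
refine (@Moncat pivcat pivtens pivunit piv_tensm _ _ _ _ _ _ _ _).
- by move=> p q; apply: pivmor_eq; apply: tensm1.
- by move=> *; apply: pivmor_eq; apply: tensmM.
- exact: pivtensA.
- exact: pivtens1x.
- exact: pivtensx1.
- by move=> *; apply: pivmor_eqv; rewrite ?pivtensA //; apply: tensmA.
- by move=> *; apply: pivmor_eqv; rewrite ?pivtens1x //; apply: tens1m.
- by move=> *; apply: pivmor_eqv; rewrite ?pivtensx1 //; apply: tensm1r.
Defined.

Definition iso_id (X : C) : iso X X :=
  @Iso C X X (idm X) (idm X) (conj (comp1m (idm X)) (comp1m (idm X))).

(** The forgetful functor [(P, Q) ↦ P], strict monoidal. *)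
Definition forget : smfunctor pivcover C.
Proof.
refine (@SMFunctor pivcover C pP (fun p q (f : pivmor p q) => pm f) _ _
  (fun p q => iso_id (pP p ⊗ pP q)) (iso_id 𝟙) _ _ _ _) => //=.
- by move=> *; rewrite compm1 comp1m.
- by move=> *; rewrite !tensm1 !comp1m /= tensA.
- by move=> X; rewrite tensm1 comp1m tens1x.
- by move=> X; rewrite tensm1 comp1m tensx1.
Defined.

(** The pair [(Q, P)] is both the left and the right dual of [(P, Q)]. *)
Definition pivswap (p : pivpair) : pivpair :=
  PivPair (prev_dual p) (pev_dual p).

Lemma is_pivmor_ev (p : pivpair) :
  @is_pivmor (pivtens (pivswap p) p) pivunit (pev p).
Proof.
apply/is_pivmorP; exists (prcoev p).
have /pk_is_dual [l r] := prev_dual p.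
split; apply: pk_inj; rewrite /= !pk_comp !pk_recast; flat; rewrite -ocA.
  move/(f_equal (fun a => @ot C a (pk (idm (pP p))))): l; dist; flat=> ->.
  by rewrite -pk_id oc1 // oc1r.
move/(f_equal (fun a => @ot C (pk (idm (pQ p))) a)): r; dist; flat=> ->.
by rewrite -pk_id oc1 // oc1r.
Qed.

Lemma is_pivmor_coev (p : pivpair) :
  @is_pivmor pivunit (pivtens p (pivswap p)) (pcoev p).
Proof.
apply/is_pivmorP; exists (prev p).
have /pk_is_dual [l r] := pev_dual p.
split; apply: pk_inj; rewrite /= !pk_comp !pk_recast; flat; rewrite -ocA.
  move/(f_equal (fun a => @ot C (pk (idm (pP p))) a)): r; dist; flat=> ->.
  by rewrite -pk_id oc1 // oc1r.
move/(f_equal (fun a => @ot C a (pk (idm (pQ p))))): l; dist; flat=> ->.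
by rewrite -pk_id oc1 // oc1r.
Qed.

Definition pivcover_duality : duality pivcover := @Duality pivcover
  pivswap (fun p => PivMor (is_pivmor_ev p)) (fun p => PivMor (is_pivmor_coev p))
  pivswap (fun p => PivMor (is_pivmor_ev (pivswap p)))
          (fun p => PivMor (is_pivmor_coev (pivswap p))).

(** The double dual of [(P, Q)] is [(P, Q)], and the pivotal structure is the
    identity. *)
Definition pivcover_pivotal : pivotal_data pivcover :=
  @PivotalData pivcover pivcover_duality (fun p => @idm pivcover p).

End PivotalCover.
Arguments pivcover_pivotal : clear implicits.
Arguments forget : clear implicits.

(** * Composition of strong monoidal functors *)

Section Compose.
Variables (D E C : moncat) (F : smfunctor E C) (G : smfunctor D E).

Lemma is_inverse_comp (X Y Z : C) (g : hom Y Z) (f : hom X Y) g' f' :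
  is_inverse g g' -> is_inverse f f' -> is_inverse (g ∘ f) (f' ∘ g').
Proof.
move=> [g1 g2] [f1 f2]; split.
  by rewrite compA -(compA f' g' g) g1 compm1.
by rewrite compA -(compA g f f') f2 compm1.
Qed.

Lemma is_inverse_fmap (X Y : E) (f : hom X Y) g :
  is_inverse f g -> is_inverse (fmap F f) (fmap F g).
Proof. by move=> [f1 f2]; split; rewrite -fmapM ?f1 ?f2 fmap1. Qed.

Definition comp_fun2 (X Y : D) : iso (F (G X) ⊗ F (G Y)) (F (G (X ⊗ Y))) :=
  Iso (is_inverse_comp (is_inverse_fmap (isoP (fun2 G X Y)))
                       (isoP (fun2 F (G X) (G Y)))).

Definition comp_fun0 : iso 𝟙 (F (G 𝟙)) :=
  Iso (is_inverse_comp (is_inverse_fmap (isoP (fun0 G))) (isoP (fun0 F))).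

Lemma fmap_eqv (X Y X' Y' : E) (f : hom X Y) (g : hom X' Y') :
  f ≡ g -> fmap F f ≡ fmap F g.
Proof. exact: (f_equal (fun a => Arrow (fmap F (arr a)))). Qed.

Lemma comp_eqv (X Y Z X' Y' Z' : C) (g : hom Y Z) (f : hom X Y)
    (g' : hom Y' Z') (f' : hom X' Y') : g ≡ g' -> f ≡ f' -> g ∘ f ≡ g' ∘ f'.
Proof.
by move=> eg ef; apply: pkE; rewrite !pk_comp {1}/pk eg {1}[pk f]/pk ef.
Qed.

Lemma fun2_wr (X X' Y : E) (f : hom X X') :
  fun2 F X' Y ∘ (fmap F f ▷ F Y) = fmap F (f ▷ Y) ∘ fun2 F X Y.
Proof. by rewrite fun2_nat fmap1. Qed.

Lemma fun2_wl (X Y Y' : E) (f : hom Y Y') :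
  fun2 F X Y' ∘ (F X ◁ fmap F f) = fmap F (X ◁ f) ∘ fun2 F X Y.
Proof. by rewrite fun2_nat fmap1. Qed.

Definition comp_smfunctor : smfunctor D C.
Proof.
refine (@SMFunctor D C (fun X => F (G X)) (fun X Y f => fmap F (fmap G f)) _ _
  comp_fun2 comp_fun0 _ _ _ _).
- by move=> X; rewrite !fmap1.
- by move=> *; rewrite !fmapM.
- move=> X Y X' Y' f f' /=.
  by rewrite compA -fmapM fun2_nat fmapM -!compA fun2_nat.
- move=> X Y Z /=.
  rewrite -[in LHS](comp1m (idm (F (G Z)))) tensmM.
  rewrite -[in RHS](comp1m (idm (F (G X)))) tensmM.
  rewrite !compA -[in LHS](compA (fmap F _) (fun2 F _ _)) fun2_wr.
  rewrite -[in RHS](compA (fmap F _) (fun2 F _ _)) fun2_wl.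
  rewrite !compA -!fmapM -!compA; apply: comp_eqv (fun2A F _ _ _).
  by apply: fmap_eqv; apply: fun2A.
- move=> X /=; rewrite -(comp1m (idm (F (G X)))) tensmM.
  rewrite !compA -(compA (fmap F _) (fun2 F _ _)) fun2_wr !compA -!fmapM -!compA.
  rewrite comp1m (comp_eqv (fmap_eqv (fun21l G X)) (fun21l F (G X))).
  by rewrite fmap1 comp1m.
- move=> X /=; rewrite -(comp1m (idm (F (G X)))) tensmM.
  rewrite !compA -(compA (fmap F _) (fun2 F _ _)) fun2_wl !compA -!fmapM -!compA.
  rewrite comp1m (comp_eqv (fmap_eqv (fun21r G X)) (fun21r F (G X))).
  by rewrite fmap1 comp1m.
Defined.

End Compose.

(* Main.v *)
From Stdlib Require Import ssreflect ssrfun.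
From Stdlib Require Import ProofIrrelevance FunctionalExtensionality ClassicalEpsilon.
Require Import Defs.

(** Why the theorem holds.  A morphism into a chosen dual [Q] of [P] is
    determined by what it becomes after evaluation ([ev_inj]): if
    [ev ∘ (h ⊗ P) = ev ∘ (k ⊗ P)] then [h = k].  All the canonical morphisms of
    the theory (transposes, the monoidal structure of the double dual, the
    comparison [F(ᵛX) -> ᵛF(X)]) are transposes of explicit evaluations, so each
    of them is replaced by the one equation that characterizes it.

    The pivotal cover is pivotal.  Its duality morphisms satisfy the triangle
    identities because those of each pair do.  Identities form a pivotal structure
    because the right transpose of a pivotal morphism is also its left transpose,
    so that [ᵛᵛf = f], and because [ᵛ(p ⊗ q)] is the tensor product [ᵛq ⊗ ᵛp],
    duality morphisms included ([lev_cover_tens]).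

    Existence.  In a pivotal category [D] the left dual [ᵛX] is also a right dual
    of [X]: transport the duality between [ᵛX] and [ᵛᵛX] along [rho X].  This gives a
    pivotal pair [selfpair X] over [X].  Naturality of [rho] says that every
    morphism of [D] is pivotal between these pairs, and monoidality of [rho] that
    the identities of [X ⊗ Y] and of [𝟙] are pivotal, i.e. that the pairs are
    compatible with tensor products.  A strong monoidal functor [G] sends dual
    pairs to dual pairs ([fun_dual]), hence pivotal pairs to pivotal pairs, and its
    structure isomorphisms are pivotal.  So [X ↦ G(selfpair X)] underlies a strong
    monoidal functor [lift] over [G].

    Uniqueness.  Respecting pivotal structures is a statement about the comparison
    [ζ_X] alone ([preserves_pivotal_at]): it says that [ζ_X], which always
    intertwines the left evaluation of [F(X)] with the image of that of [X], also
    intertwines the right evaluations.  For a functor [F] over [G] with values in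
    the cover this is exactly the criterion [is_pivmorP] for the identity of
    [G(X)] to be a pivotal morphism from [F(X)] to [lift X].  Its inverse is
    pivotal too, so the identities form an isomorphism from [lift] to [F]; being
    over the identity of [G] leaves no choice. *)

Set Implicit Arguments.
Unset Strict Implicit.
Unset Printing Implicit Defensive.

Open Scope moncat_scope.

#[local] Arguments oc : simpl never.

(** * Evaluations determine morphisms *)

Lemma pk_eqv (E : category) (X Y X' Y' : E) (f : hom X Y) (g : hom X' Y') :
  f ≡ g -> pk f = pk g.
Proof. exact: (f_equal (@Some _)). Qed.

Section Evaluations.
Variable C : moncat.
Implicit Types (X Y Z P Q : C).
Local Notation I X := (pk (idm X)).

Lemma whisker_compr X Y Z W (g : hom Y Z) (f : hom X Y) :
  (g ∘ f) ▷ W = (g ▷ W) ∘ (f ▷ W).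
Proof. by rewrite -tensmM comp1m. Qed.

Lemma whisker_compl X Y Z W (g : hom Y Z) (f : hom X Y) :
  W ◁ (g ∘ f) = (W ◁ g) ∘ (W ◁ f).
Proof. by rewrite -tensmM comp1m. Qed.

Lemma whiskerC X Y X' Y' (f : hom X Y) (g : hom X' Y') :
  (f ▷ Y') ∘ (X ◁ g) = (Y ◁ g) ∘ (f ▷ X').
Proof. by rewrite -!tensmM !comp1m !compm1. Qed.

Lemma whiskerE X Y X' Y' (f : hom X Y) (g : hom X' Y') :
  f ⊗₁ g = (f ▷ Y') ∘ (X ◁ g).
Proof. by rewrite -tensmM comp1m compm1. Qed.

Lemma comp_tensm1 X Y Z (f : hom (X ⊗ Y) Z) :
  f ∘ (idm X ⊗₁ idm Y) = f.
Proof. by rewrite tensm1 compm1. Qed.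

(** The transpose of [idm P] for [e] and a duality of [P] is the morphism
    into [Q] corresponding to [e]; this is the form in which canonical morphisms are recognized
    below. *)
Lemma ev_ltranspose (P Q Q' : C) (ev : hom (Q ⊗ P) 𝟙) (coev : hom 𝟙 (P ⊗ Q))
    (e : hom (Q' ⊗ P) 𝟙) : is_dual ev coev ->
  ev ∘ (ltranspose e coev (idm P) ▷ P) = e.
Proof.
move=> dl; have [/(_ erefl) -> _] := ltransposeP e (idm P) (ltranspose e coev (idm P)) dl.
by rewrite tensm1 compm1.
Qed.

(** A dual of [P] represents the functor [hom (- ⊗ P) 𝟙]. *)
Lemma ev_inj (P Q Q' : C) (ev : hom (Q ⊗ P) 𝟙) (coev : hom 𝟙 (P ⊗ Q))
    (h k : hom Q' Q) : is_dual ev coev -> ev ∘ (h ▷ P) = ev ∘ (k ▷ P) -> h = k.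
Proof.
move=> dl e; have H l := ltransposeP (ev ∘ (k ▷ P)) (idm P) l dl.
transitivity (ltranspose (ev ∘ (k ▷ P)) coev (idm P)).
  by apply/H; rewrite tensm1 compm1.
by symmetry; apply/H; rewrite tensm1 compm1.
Qed.

(** One member of a dual pair may be replaced by an isomorphic object.  In the
    second triangle [i] moves past [coev] and [j] past the evaluation, which
    leaves [j ∘ i]. *)
Lemma dual_iso (P Q Q' : C) (ev : hom (Q ⊗ P) 𝟙) (coev : hom 𝟙 (P ⊗ Q))
    (i : hom Q' Q) (j : hom Q Q') : is_dual ev coev -> is_inverse i j ->
  is_dual (ev ∘ (i ▷ P)) ((P ◁ j) ∘ coev).
Proof.
move=> /pk_is_dual [l r] [ji ij]; apply/pk_is_dual; split.
  flat; dist; rewrite -[RHS]l; congr (oc _ _).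
  rewrite ocA -[RHS](oc1 (X := P ⊗ Q ⊗ P)); [side|]; congr (oc _ _).
  by rewrite -!pk_tens -pk_comp -!tensmM ij !comp1m !tensm1.
flat; dist.
have ei := slide (a := pk i) (b := pk coev) erefl erefl erefl erefl.
have ej := slide (a := pk (ev ∘ (i ▷ P))) (b := pk j) erefl erefl erefl erefl.
move: ei ej; flat; dist; flat => ei ej.
rewrite [X in oc _ X]ocA ocA -ej -!ocA -ei [X in oc _ X]ocA r oc1 //.
by rewrite -pk_comp ji.
Qed.
End Evaluations.

(** * Strong monoidal functors preserve duals *)

Section FunctorDuals.
Variables (D C : moncat) (F : smfunctor D C).

Definition fun_ev (P Q : D) (ev : hom (Q ⊗ P) 𝟙) : hom (F Q ⊗ F P) 𝟙 :=
  bwd (fun0 F) ∘ fmap F ev ∘ fun2 F Q P.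

Definition fun_coev (P Q : D) (coev : hom 𝟙 (P ⊗ Q)) : hom 𝟙 (F P ⊗ F Q) :=
  bwd (fun2 F P Q) ∘ fmap F coev ∘ fun0 F.

Lemma fun_ev_nat (P Q P' Q' : D) (ev : hom (Q ⊗ P) 𝟙) (f : hom P' P)
    (g : hom Q' Q) :
  fun_ev (ev ∘ (g ⊗₁ f)) = fun_ev ev ∘ (fmap F g ⊗₁ fmap F f).
Proof. by rewrite /fun_ev fmapM -!compA fun2_nat. Qed.

Local Notation I X := (pk (idm X)).

(** The unit axioms of [F] say that tensoring the unit isomorphism with [F X]
    gives, up to strictness, an inverse of [fun2]; the next four lemmas solve them
    for each factor, which eliminates [fun0] from the computations below. *)
Lemma fun0V_r X : F X ◁ bwd (fun0 F) ≡ fun2 F X 𝟙.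
Proof.
have [_ e] := isoP (fun0 F); apply: pkE.
have := pk_eqv (fun21r F X); rewrite pk_comp => E.
rewrite -[LHS](oc1 (X := F X)); [side|].
by rewrite -E -ocA -pk_comp -whisker_compl e tensm1 oc1r.
Qed.

Lemma fun0V_l X : bwd (fun0 F) ▷ F X ≡ fun2 F 𝟙 X.
Proof.
have [_ e] := isoP (fun0 F); apply: pkE.
have := pk_eqv (fun21l F X); rewrite pk_comp => E.
rewrite -[LHS](oc1 (X := F X)); [side|].
by rewrite -E -ocA -pk_comp -whisker_compr e tensm1 oc1r.
Qed.

Lemma fun0_r X : F X ◁ fun0 F ≡ bwd (fun2 F X 𝟙).
Proof.
have [e _] := isoP (fun2 F X 𝟙); apply: pkE.
have := pk_eqv (fun21r F X); rewrite pk_comp => E.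
rewrite -[LHS](oc1 (X := F X ⊗ F 𝟙)); [side|].
by rewrite -e pk_comp -ocA E oc1r //= tensx1.
Qed.

Lemma fun0_l X : fun0 F ▷ F X ≡ bwd (fun2 F 𝟙 X).
Proof.
have [e _] := isoP (fun2 F 𝟙 X); apply: pkE.
have := pk_eqv (fun21l F X); rewrite pk_comp => E.
rewrite -[LHS](oc1 (X := F 𝟙 ⊗ F X)); [side|].
by rewrite -e pk_comp -ocA E oc1r //= tens1x.
Qed.

Lemma fun2V_nat (X Y X' Y' : D) (f : hom X Y) (f' : hom X' Y') :
  bwd (fun2 F Y Y') ∘ fmap F (f ⊗₁ f') =
  (fmap F f ⊗₁ fmap F f') ∘ bwd (fun2 F X X').
Proof.
have [e _] := isoP (fun2 F Y Y'); have [_ e'] := isoP (fun2 F X X').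
rewrite -[LHS]compm1 -e' -compA (compA (fmap F _)) fun2_nat !compA e.
by rewrite comp1m.
Qed.

(** Tensoring an image under [F] with an object [F R] moves inside [F] at the cost
    of structure isomorphisms; the next four lemmas do so for evaluations and
    coevaluations on both sides. *)
Lemma fun_ev_l R P Q (ev : hom (Q ⊗ P) 𝟙) : F R ◁ fun_ev ev ≡
  fmap F (R ◁ ev) ∘ fun2 F R (Q ⊗ P) ∘ (F R ◁ fun2 F Q P).
Proof.
rewrite /fun_ev !whisker_compl -fun2_wl.
by do 2 apply: comp_eqv => //; exact: fun0V_r.
Qed.

Lemma fun_ev_r R P Q (ev : hom (Q ⊗ P) 𝟙) : fun_ev ev ▷ F R ≡
  fmap F (ev ▷ R) ∘ fun2 F (Q ⊗ P) R ∘ (fun2 F Q P ▷ F R).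
Proof.
rewrite /fun_ev !whisker_compr -fun2_wr.
by do 2 apply: comp_eqv => //; exact: fun0V_l.
Qed.

Lemma fun_coev_l R P Q (coev : hom 𝟙 (P ⊗ Q)) : F R ◁ fun_coev coev ≡
  (F R ◁ bwd (fun2 F P Q)) ∘ (bwd (fun2 F R (P ⊗ Q)) ∘ fmap F (R ◁ coev)).
Proof.
rewrite /fun_coev !whisker_compl fun2V_nat fmap1 -compA.
by do 2 apply: comp_eqv => //; exact: fun0_r.
Qed.

Lemma fun_coev_r R P Q (coev : hom 𝟙 (P ⊗ Q)) : fun_coev coev ▷ F R ≡
  (bwd (fun2 F P Q) ▷ F R) ∘ (bwd (fun2 F (P ⊗ Q) R) ∘ fmap F (coev ▷ R)).
Proof.
rewrite /fun_coev !whisker_compr fun2V_nat fmap1 -compA.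
by do 2 apply: comp_eqv => //; exact: fun0_l.
Qed.

Lemma pk_fmap_comp (X Y Y' Z X' Z' : D) (g : hom Y' Z) (f : hom X Y)
    (h : hom X' Z') : Y = Y' -> oc (pk g) (pk f) = pk h ->
  oc (pk (fmap F g)) (pk (fmap F f)) = pk (fmap F h).
Proof.
move=> e; subst Y'; rewrite -!pk_comp -fmapM => /pkE e.
by apply: pk_eqv; apply: fmap_eqv.
Qed.

(** Once both whiskered factors are brought inside [F], associativity of [fun2]
    cancels the structure isomorphisms between them, and what remains is the image
    under [F] of a triangle identity. *)
Lemma fun_dual (P Q : D) (ev : hom (Q ⊗ P) 𝟙) (coev : hom 𝟙 (P ⊗ Q)) :
  is_dual ev coev -> is_dual (fun_ev ev) (fun_coev coev).
Proof.
move=> /pk_is_dual [l r]; apply/pk_is_dual; rewrite -!pk_tens.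
rewrite (pk_eqv (fun_ev_l _ _)) (pk_eqv (fun_coev_r _ _)).
rewrite (pk_eqv (fun_ev_r _ _)) (pk_eqv (fun_coev_l _ _)).
have A X Y Z : pk (fun2 F X (Y ⊗ Z) ∘ (F X ◁ fun2 F Y Z)) =
    pk (fun2 F (X ⊗ Y) Z ∘ (fun2 F X Y ▷ F Z)) by rewrite (pk_eqv (fun2A F X Y Z)).
have i X Y : fun2 F X Y ∘ bwd (fun2 F X Y) = idm _ by case: (isoP (fun2 F X Y)).
split.
  rewrite -compA pk_comp A -ocA -pk_comp.
  rewrite -compA (compA (fun2 F P Q ▷ _)) -whisker_compr i tensm1 comp1m.
  rewrite compA i comp1m -(fmap1 F P).
  by apply: pk_fmap_comp; rewrite ?tensA.
rewrite -compA pk_comp -A -ocA -pk_comp.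
rewrite -compA (compA (F Q ◁ fun2 F P Q)) -whisker_compl i tensm1 comp1m.
rewrite compA i comp1m -(fmap1 F Q).
by apply: pk_fmap_comp; rewrite ?tensA.
Qed.

(** The two ways of multiplying four factors used by [tens_ev]: inner pair
    first, or two by two. *)
Lemma fun2_four (X Y Z T : D) :
  fun2 F X ((Y ⊗ Z) ⊗ T) ∘ (F X ◁ (fun2 F (Y ⊗ Z) T ∘ (fun2 F Y Z ▷ F T))) ≡
  fun2 F (X ⊗ Y) (Z ⊗ T) ∘ (fun2 F X Y ⊗₁ fun2 F Z T).
Proof.
have E : pk (fun2 F X ((Y ⊗ Z) ⊗ T)) = pk (fun2 F X (Y ⊗ Z ⊗ T)) by rewrite tensA.
apply: pkE; rewrite (whiskerE (fun2 F X Y)) compA [RHS]pk_comp (pk_eqv (fun2A F _ _ _)).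
rewrite pk_tens pk_id otA -!pk_tens [in RHS]pk_comp -ocA -pk_comp -whisker_compl.
by rewrite [in RHS]pk_tens -(pk_eqv (fun2A F _ _ _)) -pk_tens pk_comp E.
Qed.

(** The dual pair that [F] makes out of a tensor product agrees with the tensor
    product of the images; this is why [fun2] is a pivotal morphism. *)
Lemma fun_ev_tens (P1 Q1 P2 Q2 : D) (ev1 : hom (Q1 ⊗ P1) 𝟙)
    (ev2 : hom (Q2 ⊗ P2) 𝟙) :
  tens_ev (fun_ev ev1) (fun_ev ev2) =
  fun_ev (tens_ev ev1 ev2) ∘ (fun2 F Q2 Q1 ⊗₁ fun2 F P1 P2).
Proof.
have E : pk (fun2 F Q2 P2) = pk (fun2 F Q2 (𝟙 ⊗ P2)) by rewrite tens1x.
apply: pk_inj; rewrite pk_recast pk_scomp pk_tens (pk_eqv (fun_ev_r _ _)).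
rewrite -pk_tens -(compA (fmap F (ev1 ▷ P2))) whisker_compl {1}/fun_ev.
rewrite [in X in oc X _]pk_comp E -ocA -pk_comp compA fun2_wl /fun_ev.
rewrite -[in LHS]compA -[in RHS]compA pk_comp.
rewrite [in LHS]pk_comp [in RHS]pk_comp (pk_eqv (fun2_four _ _ _ _)).
rewrite [in LHS]pk_comp [in RHS]pk_comp -!ocA; congr (oc _ _).
rewrite -pk_comp ocA; congr (oc _ _); apply: pk_fmap_comp; first by rewrite tens1x.
by rewrite pk_recast pk_scomp.
Qed.
End FunctorDuals.

(** * Canonical morphisms between duals, characterized by evaluation *)

Section DoubleDual.
Variables (C : moncat) (d : duality C).
Hypothesis rd : is_rigid d.
Implicit Types (X Y : C).

Lemma lev_ldualm X Y (f : hom X Y) :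
  lev d X ∘ (ldualm d f ▷ X) = lev d Y ∘ (ldual d Y ◁ f).
Proof. by apply/(ltransposeP _ _ _ (proj1 rd X)). Qed.

Lemma lev_ldual2 X Y :
  lev d (X ⊗ Y) ∘ (ldual2 d X Y ▷ (X ⊗ Y)) = tens_ev (lev d X) (lev d Y).
Proof.
rewrite -[RHS](ev_ltranspose _ (proj1 rd (X ⊗ Y))); congr (_ ∘ (_ ▷ _)).
apply: pk_inj; rewrite pk_ltranspose; flat; dist.
by rewrite -!pk_id oc1 //= !tensA.
Qed.

Lemma tens_ev_ldual2V X Y :
  tens_ev (lev d X) (lev d Y) ∘ (ldual2V d X Y ▷ (X ⊗ Y)) = lev d (X ⊗ Y).
Proof.
have dl := dual_tens (proj1 rd X) (proj1 rd Y).
rewrite -[RHS](ev_ltranspose _ dl); congr (_ ∘ (_ ▷ _)).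
apply: pk_inj; rewrite pk_ltranspose; flat; dist.
congr (oc _ _); rewrite ocA; congr (oc _ _).
by rewrite -!pk_id oc1 //= !tensA.
Qed.

(** Together with monoidality of [rho], this determines the right evaluation of
    [X ⊗ Y] in a pivotal category. *)
Lemma lev_lldual2 X Y :
  lev d (ldual d (X ⊗ Y)) ∘ (lldual2 d X Y ▷ ldual d (X ⊗ Y)) =
  tens_ev (lev d (ldual d Y)) (lev d (ldual d X)) ∘
    ((ldual d (ldual d X) ⊗ ldual d (ldual d Y)) ◁ ldual2V d X Y).
Proof.
rewrite whisker_compr compA lev_ldualm -compA -whiskerC compA.
by rewrite lev_ldual2.
Qed.

(** Modulo strictness the triangle identity at [𝟙] reads [lev ∘ lcoev = 1]. *)
Lemma lev_lldual0 :
  lev d (ldual d 𝟙) ∘ (lldual0 d ▷ ldual d 𝟙) ≡ ldual0V d.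
Proof.
rewrite whisker_compr compA lev_ldualm -compA -whiskerC compA.
apply: pkE; rewrite pk_comp; flat.
have /pk_is_dual [l _] := proj1 rd 𝟙.
by move: l; rewrite ot1m otm1 => ->; rewrite oc1.
Qed.

End DoubleDual.

(** * Preservation of pivotal structures, in terms of evaluations *)

Section Comparison.
Variables (D C : moncat) (d : pivotal_data D) (c : pivotal_data C).
Variable F : smfunctor D C.
Hypothesis rc : is_rigid c.

Lemma lev_zeta X :
  lev c (F X) ∘ (zeta d c F X ▷ F X) = fun_ev F (lev d X).
Proof.
rewrite -[RHS](ev_ltranspose _ (proj1 rc (F X))); congr (_ ∘ (_ ▷ _)).
apply: pk_inj; rewrite pk_ltranspose pk_recast pk_scomp -/(fun_ev F _).
congr (oc _ _); flat.
by rewrite -!pk_id oc1 //= ?tensA.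
Qed.

(** The defining equation equates two morphisms [F X -> ᵛᵛF(X)], so it may be
    tested under [lev (ᵛF X)].  Composing with the isomorphism [ζ_X] as well
    removes its inverse, and with it the transpose, from the equation: [ζ_X] sends
    the right evaluation of [F X] to the image of that of [X]. *)
Lemma preserves_pivotal_at X (zi : hom _ _) :
  is_inverse (zeta d c F X) zi ->
  rho c (F X) = ldualm c zi ∘ zeta d c F (ldual d X) ∘ fmap F (rho d X) <->
  lev c (ldual c (F X)) ∘ (rho c (F X) ⊗₁ zeta d c F X) =
  fun_ev F (lev d (ldual d X) ∘ (rho d X ▷ ldual d X)).
Proof.
move=> [e1 e2]; set g := ldualm c zi ∘ _ ∘ _.
have eg : lev c (ldual c (F X)) ∘ (g ⊗₁ zeta d c F X) =
    fun_ev F (lev d (ldual d X) ∘ (rho d X ▷ ldual d X)).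
  rewrite /g -compA -[zeta _ _ _ X]comp1m tensmM compA lev_ldualm //.
  rewrite -compA -tensmM e1 comp1m whisker_compr compA lev_zeta.
  by rewrite fun_ev_nat fmap1.
split=> [-> //|]; rewrite -eg => e; apply: ev_inj (proj1 rc _) _.
move/(f_equal (fun h => h ∘ (F X ◁ zi))): e.
by rewrite -!compA -!tensmM e2 !compm1.
Qed.

End Comparison.

(** * The pivotal cover is pivotal *)

Section CoverPivotal.
Variable C : moncat.
Implicit Types p q : pivcover C.

Lemma pm_recast p q p' q' (f : hom p q) (e : strict_eq p p')
    (e' : strict_eq q q') : pk (pm (@recast _ p q p' q' f e e')) = pk (pm f).
Proof. by case: q' / e'; case: p' / e. Qed.

Lemma pm_scomp p q q' r (g : hom q' r) (f : hom p q) (e : strict_eq q q') :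
  pk (pm (@scomp _ p q q' r g f e)) = oc (pk (pm g)) (pk (pm f)).
Proof. by case: q' / e g => g; rewrite -pk_comp. Qed.

(** The forgetful functor is faithful and strict, so it reflects the triangle
    identities. *)
Lemma is_dual_cover p q (ev : hom (q ⊗ p) 𝟙) (coev : hom 𝟙 (p ⊗ q)) :
  is_dual (pm ev) (pm coev) -> is_dual ev coev.
Proof.
move=> /pk_is_dual [l r]; split.
  apply: (pivmor_eqv (tens1x p) (tensx1 p)).
  by apply: pkE; rewrite pm_scomp.
apply: (pivmor_eqv (tensx1 q) (tens1x q)).
by apply: pkE; rewrite pm_scomp.
Qed.

Lemma pivcover_rigid : is_rigid (pivcover_pivotal C).
Proof.
split=> p; apply: is_dual_cover; first exact: pev_dual p.
exact: prev_dual p.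
Qed.

(** If [h] is the common transpose of [f], the left transpose [k] of [g] is a right
    inverse of [h] by functoriality of left transposition.  Cancelling [h] against
    [k] under the right evaluations shows that [k] is the right transpose of [g]. *)
Lemma is_pivmor_inv p q (f : hom (pP p) (pP q)) g :
  is_pivmor f -> is_inverse f g -> is_pivmor g.
Proof.
move=> /is_pivmorP [h [hl hr]] [gf fg]; apply/is_pivmorP.
set k := ltranspose (pev p) (pcoev q) g.
have kl : pev q ∘ (k ▷ pP q) = pev p ∘ (pQ p ◁ g).
  by apply/(ltransposeP _ _ _ (pev_dual q)).
exists k; split=> //.
have hk : h ∘ k = idm _.
  apply: ev_inj (pev_dual p) _.
  rewrite whisker_compr compA hl -compA -whiskerC compA kl -compA.
  by rewrite -whisker_compl gf tensm1.
transitivity (prev q ∘ (f ▷ pQ q) ∘ (g ⊗₁ k)).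
  by rewrite -compA -tensmM fg comp1m.
by rewrite -hr -compA -tensmM hk comp1m.
Qed.

Lemma pivcover_inverse p q (f : @hom (pivcover C) p q) g
    (fg : is_inverse (pm f) g) : is_inverse f (PivMor (is_pivmor_inv (pmP f) fg)).
Proof. by case: fg => e1 e2; split; apply: pivmor_eq. Qed.

Lemma pm_tens_ev (p1 q1 p2 q2 : pivcover C) (ev1 : hom (q1 ⊗ p1) 𝟙)
    (ev2 : hom (q2 ⊗ p2) 𝟙) :
  pm (tens_ev ev1 ev2) = tens_ev (pm ev1) (pm ev2).
Proof. by apply: pk_inj; rewrite pm_recast pm_scomp pk_recast pk_scomp. Qed.

Local Notation pc := (pivcover_pivotal C).

(** In the cover, the chosen dual of a tensor product is the tensor product of the
    chosen duals in reverse order, on the nose. *)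
Lemma lev_cover_tens p q :
  tens_ev (lev pc p) (lev pc q) = lev pc (p ⊗ q).
Proof. by apply: pivmor_eq; rewrite pm_tens_ev. Qed.

(** Each axiom is tested under the evaluation [lev (ᵛp)], whose underlying morphism
    is the right evaluation of [p]. *)
Lemma pivcover_is_pivotal : is_pivotal (pivcover_pivotal C).
Proof.
have rg := pivcover_rigid; split=> //.
- by move=> p; exists (idm p); split; apply: comp1m.
- move=> p q f; rewrite -[rho _ p]/(idm p) -[rho _ q]/(idm q) comp1m compm1.
  apply: ev_inj (proj1 rg _) _.
  apply: etrans (esym (lev_ldualm rg (ldualm (pivcover_pivotal C) f))).
  have e : pm (ldualm (pivcover_pivotal C) f) = ltranspose (pev q) (pcoev p) (pm f).
    by apply: pk_inj; rewrite pm_recast !pm_scomp pk_ltranspose -ocA.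
  (* A pivotal morphism is one whose left transpose is its right transpose, so
     transposing it on the left twice gives it back. *)
  apply: pivmor_eq; symmetry.
  apply/(rtransposeP _ _ _ (prev_dual p)).
  by rewrite e; apply: pmP.
- move=> p q; rewrite -[rho _ p]/(idm p) -[rho _ q]/(idm q) tensm1 compm1.
  apply: ev_inj (proj1 rg _) _.
  apply: etrans (esym (lev_lldual2 rg p q)).
  have -> : ldual2V (pivcover_pivotal C) p q = idm _.
    apply: ev_inj (dual_tens (proj1 rg p) (proj1 rg q)) _.
    apply: etrans (tens_ev_ldual2V rg p q) _.
    by rewrite tensm1 compm1 lev_cover_tens.
  apply: etrans (comp_tensm1 (lev pc (ldual pc (p ⊗ q)))) (esym _).
  exact: etrans (comp_tensm1 _) (lev_cover_tens (ldual pc q) (ldual pc p)).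
- apply: ev_inj (proj1 rg _) _.
  apply: etrans (comp_tensm1 (lev pc (ldual pc 𝟙))) _.
  have e := pk_eqv (fmap_eqv (forget C) (lev_lldual0 rg)).
  apply: pivmor_eq; apply: pk_inj; apply: etrans (esym e).
  by rewrite [RHS](pm_recast (lev pc 𝟙)).
Qed.
End CoverPivotal.

(** * Images of pivotal pairs under a strong monoidal functor *)

Section PairImages.
Variables (D C : moncat) (F : smfunctor D C).

Definition fpair (p : pivpair D) : pivpair C :=
  PivPair (fun_dual F (pev_dual p)) (fun_dual F (prev_dual p)).

Lemma is_pivmor_fmap (p q : pivpair D) (f : hom (pP p) (pP q)) :
  is_pivmor f -> @is_pivmor _ (fpair p) (fpair q) (fmap F f).
Proof.
move=> /is_pivmorP [h [hl hr]]; apply/is_pivmorP; exists (fmap F h) => /=.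
by rewrite -!fmap1 -!fun_ev_nat hl hr.
Qed.

(** The transpose of [fun2] is the inverse of [fun2] on the dual objects. *)
Lemma is_pivmor_fun2 (p q : pivpair D) :
  @is_pivmor _ (pivtens (fpair p) (fpair q)) (fpair (pivtens p q))
    (fun2 F (pP p) (pP q)).
Proof.
have [_ e] := isoP (fun2 F (pQ q) (pQ p)).
apply/is_pivmorP; exists (bwd (fun2 F (pQ q) (pQ p))) => /=.
by rewrite !fun_ev_tens -!compA -!tensmM e !compm1.
Qed.

(** The transpose of [fun0] is its inverse. *)
Lemma is_pivmor_fun0 :
  @is_pivmor _ (pivunit C) (fpair (pivunit D)) (fun0 F).
Proof.
have e : pk (fmap F (⌊idm 𝟙⌋ : hom (𝟙 ⊗ 𝟙) (𝟙 : D))) = pk (idm (F 𝟙)).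
  by rewrite -fmap1; apply/pk_eqv/fmap_eqv/pkE/pk_recast.
apply/is_pivmorP; exists (bwd (fun0 F)) => /=.
split; apply: pk_inj; rewrite /fun_ev -!compA.
  rewrite [RHS]pk_comp [in RHS]pk_comp (pk_eqv (fun21r F 𝟙)) e.
  by rewrite pk_comp pk_recast pk_tens otm1 !oc1 // oc1r.
rewrite [RHS]pk_comp [in RHS]pk_comp (pk_eqv (fun21l F 𝟙)) e.
by rewrite pk_comp pk_recast pk_tens ot1m !oc1 // oc1r.
Qed.

End PairImages.

(** * Objects of a pivotal category are pivotal pairs *)

Section SelfPair.
Variables (D : moncat) (d : pivotal_data D).
Hypothesis pd : is_pivotal d.
Let rd := piv_rigid pd.

Definition rhoV (X : D) : hom (ldual d (ldual d X)) X :=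
  proj1_sig (constructive_indefinite_description _ (piv_iso pd X)).

Lemma rhoVP X : is_inverse (rho d X) (rhoV X).
Proof. exact: proj2_sig (constructive_indefinite_description _ _). Qed.

(** The object [ᵛᵛX] is a left dual of [ᵛX]; replacing it by [X] along [rho X]
    makes [ᵛX] a right dual of [X]. *)
Definition selfpair (X : D) : pivpair D :=
  PivPair (proj1 rd X) (dual_iso (proj1 rd (ldual d X)) (rhoVP X)).

(** The transpose [ᵛf] is compatible with the right evaluations because these
    contain [rho], and [rho Y ∘ f = ᵛᵛf ∘ rho X]. *)
Lemma is_pivmor_self (X Y : D) (f : hom X Y) :
  @is_pivmor _ (selfpair X) (selfpair Y) f.
Proof.
apply/is_pivmorP; exists (ldualm d f); split=> /=; first exact: lev_ldualm.
rewrite -!compA whiskerC -whisker_compr piv_nat // whisker_compr !compA.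
by rewrite lev_ldualm.
Qed.

(** The transpose of the identity is the canonical isomorphism
    [ᵛ(X ⊗ Y) -> ᵛY ⊗ ᵛX]; its compatibility with the right evaluations is the
    monoidality of [rho]. *)
Lemma is_pivmor_self2 (X Y : D) :
  @is_pivmor _ (pivtens (selfpair X) (selfpair Y)) (selfpair (X ⊗ Y))
    (idm (X ⊗ Y)).
Proof.
apply/is_pivmorP; exists (ldual2V d X Y).
rewrite !tensm1 !compm1; split=> /=; first exact: tens_ev_ldual2V.
rewrite piv_tens // whisker_compr compA lev_lldual2 // -compA.
rewrite -whiskerC compA; congr (_ ∘ _); symmetry.
(* What remains is naturality of [tens_ev]: [transpose_tens] moves [rho X] and
   [rho Y] inside when the morphisms that it transposes are identities. *)
set e1 := lev d _ ∘ _; set e2 := lev d _ ∘ _.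
have := @transpose_tens D _ _ _ _ _ _ _ _ (lev d (ldual d Y))
  (lev d (ldual d X)) e1 e2 (idm _) (rho d Y) (idm _) (rho d X).
by rewrite !tensm1 !compm1 => /(_ erefl erefl).
Qed.

(** The unit part of the monoidality of [rho]. *)
Lemma is_pivmor_self0 : @is_pivmor _ (pivunit D) (selfpair 𝟙) (idm 𝟙).
Proof.
apply/is_pivmorP; exists (ldual0V d).
rewrite !tensm1 !compm1; split; apply: pk_inj.
  by rewrite pk_comp !pk_recast pk_tens otm1 pk_recast oc1.
rewrite /= piv_unit // (pk_eqv (lev_lldual0 rd)).
by rewrite pk_comp !pk_recast pk_tens ot1m pk_recast oc1.
Qed.

End SelfPair.

(** * The lift of a strong monoidal functor to the pivotal cover *)

Lemma iso_eq (C : category) (X Y : C) (f g : iso X Y) : fwd f = fwd g -> f = g.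
Proof.
case: f g => [f f' fP] [g g' gP] /= e; subst g.
have e' : f' = g'.
  by case: fP gP => [a b] [a' b']; rewrite -[f']compm1 -b' compA a comp1m.
by subst g'; rewrite (proof_irrelevance _ fP gP).
Qed.

(** The two functors share [fob] and [fm] literally, as [G] and the composite of its
    lift with the forgetful functor do up to conversion; then no transport is
    needed to compare their structure isomorphisms. *)
Lemma smfunctor_eq (D C : moncat) (fob : D -> C)
    (fm : forall X Y, hom X Y -> hom (fob X) (fob Y)) f1 fM i2 i0 n a l r
    f1' fM' i2' i0' n' a' l' r' :
  (forall X Y, fwd (i2 X Y) = fwd (i2' X Y)) -> fwd i0 = fwd i0' ->
  @SMFunctor D C fob fm f1 fM i2 i0 n a l r =
  @SMFunctor D C fob fm f1' fM' i2' i0' n' a' l' r'.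
Proof.
move=> e2 /iso_eq e0; subst i0'.
have e : i2 = i2'.
  by do 2 (apply: functional_extensionality_dep => ?); apply: iso_eq.
by subst i2'; f_equal; apply: proof_irrelevance.
Qed.

Section Lift.
Variables (D C : moncat) (d : pivotal_data D) (G : smfunctor D C).
Hypothesis pd : is_pivotal d.

Definition lift_ob (X : D) : pivcover C := fpair G (selfpair pd X).

Definition lift_map (X Y : D) (f : hom X Y) : hom (lift_ob X) (lift_ob Y) :=
  PivMor (is_pivmor_fmap G (is_pivmor_self pd f)).

Lemma is_pivmor_lift2 (X Y : D) :
  @is_pivmor _ (pivtens (lift_ob X) (lift_ob Y)) (lift_ob (X ⊗ Y)) (fun2 G X Y).
Proof.
rewrite -[fwd _]comp1m -fmap1.
exact: is_pivmorM (is_pivmor_fmap G (is_pivmor_self2 pd X Y))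
                  (is_pivmor_fun2 G (selfpair pd X) (selfpair pd Y)).
Qed.

Lemma is_pivmor_lift0 :
  @is_pivmor _ (pivunit C) (lift_ob 𝟙) (fun0 G).
Proof.
rewrite -[fwd _]comp1m -fmap1.
exact: is_pivmorM (is_pivmor_fmap G (is_pivmor_self0 pd)) (is_pivmor_fun0 G).
Qed.

Definition piv_iso (p q : pivcover C) (i : iso (pP p) (pP q))
    (fP : is_pivmor (fwd i)) : iso p q :=
  Iso (pivcover_inverse (f := PivMor fP) (isoP i)).

Definition lift : smfunctor D (pivcover C).
Proof.
refine (@SMFunctor D (pivcover C) lift_ob lift_map _ _
  (fun X Y => piv_iso (is_pivmor_lift2 X Y)) (piv_iso is_pivmor_lift0) _ _ _ _).
- by move=> X; apply: pivmor_eq; apply: fmap1.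
- by move=> X Y Z g f; apply: pivmor_eq; apply: fmapM.
- by move=> *; apply: pivmor_eq; apply: fun2_nat.
- move=> X Y Z; apply: pivmor_eqv; last exact: fun2A.
    exact: pivtensA.
  by rewrite /= tensA.
- by move=> X; apply: pivmor_eqv; [exact: pivtens1x | rewrite /= tens1x | exact: fun21l].
- by move=> X; apply: pivmor_eqv; [exact: pivtensx1 | rewrite /= tensx1 | exact: fun21r].
Defined.

Lemma forget_lift : G = comp_smfunctor (forget C) lift.
Proof.
apply: smfunctor_eq => [X Y|]; first by rewrite /= compm1.
by rewrite /= compm1.
Qed.

Lemma fun_ev_forget (F : smfunctor D (pivcover C)) (X Y : D)
    (e : hom (Y ⊗ X) 𝟙) :
  pm (fun_ev F e) = fun_ev (comp_smfunctor (forget C) F) e.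
Proof. by rewrite /fun_ev /= comp1m compm1. Qed.

Lemma fun_ev_lift (X Y : D) (e : hom (Y ⊗ X) 𝟙) :
  pm (fun_ev lift e) = fun_ev G e.
Proof. by []. Qed.

(** Here [ζ_X] is the identity, since [lift (ᵛX)] and the dual of [lift X] have the
    same underlying object and the same left evaluation. *)
Lemma preserves_lift : preserves_pivotal d (pivcover_pivotal C) lift.
Proof.
move=> X; have rc := pivcover_rigid C.
have z1 : pm (zeta d (pivcover_pivotal C) lift X) = idm _.
  apply: ev_inj (pev_dual (lift X)) _.
  have := f_equal (fun f => pm f) (lev_zeta d lift rc X).
  rewrite fun_ev_lift => e; apply: etrans e _.
  by rewrite tensm1 compm1.
have zV : is_inverse (pm (zeta d (pivcover_pivotal C) lift X)) (idm _).
  by rewrite z1; split; rewrite comp1m.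
have zP := pivcover_inverse zV; eexists; split; first exact: zP.
apply/preserves_pivotal_at => //.
apply: pivmor_eq; rewrite fun_ev_lift /=.
by rewrite z1 tensm1 compm1.
Qed.

End Lift.

(** * Uniqueness of the lift *)

Section Uniqueness.
Variables (D C : moncat) (d : pivotal_data D) (F : smfunctor D (pivcover C)).
Hypothesis pd : is_pivotal d.
Hypothesis pF : preserves_pivotal d (pivcover_pivotal C) F.
Let G := comp_smfunctor (forget C) F.

(** The comparison morphism [ζ_X] of [F] serves as the transpose of the identity:
    it respects the left evaluations by construction, and the right ones because
    [F] respects pivotal structures. *)
Lemma is_pivmor_compare (X : D) :
  @is_pivmor _ (F X) (lift G pd X) (idm (pP (F X))).
Proof.
have rc := pivcover_rigid C; have [zi [zP]] := pF X.
move=> /(preserves_pivotal_at rc zP) e.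
apply/is_pivmorP; exists (pm (zeta d (pivcover_pivotal C) F X)).
rewrite !tensm1 !compm1; split.
  have := f_equal (fun f => pm f) (lev_zeta d F rc X).
  by rewrite fun_ev_forget.
have := f_equal (fun f => pm f) e.
by rewrite fun_ev_forget.
Qed.

Definition compare (X : D) : hom (lift G pd X) (F X) :=
  PivMor (is_pivmor_inv (is_pivmor_compare X) (isoP (iso_id (pP (F X))))).

Lemma is_monoidal_iso_compare : is_monoidal_iso compare.
Proof.
split.
- by move=> X Y f; apply: pivmor_eq; rewrite /= comp1m compm1.
- by move=> X Y; apply: pivmor_eq; rewrite /= tensm1 comp1m !compm1.
- by apply: pivmor_eq; rewrite /= comp1m compm1.
- move=> X; exists (PivMor (is_pivmor_compare X)).
  by split; apply: pivmor_eq; rewrite /= comp1m.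
Qed.
End Uniqueness.

Theorem theorem3p7 (C : moncat) :
  is_pivotal (pivcover_pivotal C) /\
  forall (D : moncat) (d : pivotal_data D) (G : smfunctor D C),
    is_pivotal d ->
    exists G' : smfunctor D (pivcover C),
      G = comp_smfunctor (forget C) G' /\
      preserves_pivotal d (pivcover_pivotal C) G' /\
      forall G'' : smfunctor D (pivcover C),
        G = comp_smfunctor (forget C) G'' ->
        preserves_pivotal d (pivcover_pivotal C) G'' ->
        exists! t : forall X : D, hom (G' X) (G'' X),
          is_monoidal_iso t /\
          forall X : D, fmap (forget C) (t X) ≡ idm (G X).
Proof.
split=> [|D d G pd]; first exact: pivcover_is_pivotal.
exists (lift G pd); split; first exact: forget_lift.
split=> [|F eG pF]; first exact: preserves_lift.
subst G; exists (compare pd pF); split.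
  by split=> [|X //]; exact: is_monoidal_iso_compare.
move=> t [_ tP]; apply: functional_extensionality_dep => X.
by apply: pivmor_eq; symmetry; apply: arrow_inj; apply: tP.
Qed.
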